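(* Let $\{(N_n,B_n)\}_{n=1}^\infty$ be a sequence with $N_n>0$ and $B_n\subseteq\mathbb{R}$ finite with $\#B_n\ge 2$ for all $n\ge1$. For each $n$ let $B_{n,1}=B_n\cap\{0,1,\dots,N_n-1\}$ and $B_{n,2}=B_n\setminus B_{n,1}$. (1) If either $\sum_{n=1}^{\infty}\frac{\#B_{n,2}}{\#B_n}<\infty$, or $\sum_{n=1}^{\infty}\frac{\max\{|b|:b\in B_n\}}{N_1N_2\cdots N_n}<\infty$, then the infinite convolution $$\mu=\delta_{N_1^{-1}B_1}*\delta_{(N_2N_1)^{-1}B_2}*\cdots*\delta_{(N_n\cdots N_2N_1)^{-1}B_n}*\cdots$$ exists. (2) If there exists $r_0>0$ such that $$\sum_{n=1}^{\infty}\frac{\#\{b\in B_n:\ |b|>N_1N_2\cdots N_n r_0\}}{\#B_n}=\infty,$$ then the infinite convolution $\mu$ does not exist.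
   Context: For a finite set $A\subseteq\mathbb{R}$, $\delta_A=\frac{1}{\#A}\sum_{a\in A}\delta_a$, where $\delta_a$ is the Dirac measure at $a$; $*$ denotes convolution of measures and $cA=\{ca:a\in A\}$. Set $\mu_n=\delta_{N_1^{-1}B_1}*\delta_{(N_2N_1)^{-1}B_2}*\cdots*\delta_{(N_n\cdots N_1)^{-1}B_n}$. The infinite convolution is said to exist if $\{\mu_n\}$ converges weakly to a Borel probability measure $\mu$, which is then the infinite convolution. *)

(* Defs.v *)
From HB Require Import structures.
From mathcomp Require Import all_boot all_order all_algebra.
From mathcomp Require Import all_classical all_reals all_analysis.
Set Implicit Arguments. Unset Strict Implicit. Unset Printing Implicit Defensive.
Import Order.TTheory GRing.Theory Num.Theory.
Import numFieldNormedType.Exports.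
Local Open Scope ring_scope.
Local Open Scope classical_set_scope.

(* Indexing convention: the paper's (N_n, B_n), n >= 1, is (N (n-1), B (n-1)). *)

Definition prodN {R : realType} (N : nat -> nat) (n : nat) : R :=
  \prod_(i < n.+1) ((N i)%:R : R).

(* atoms of the discrete measure
   delta_{N_1^{-1} B_1} * ... * delta_{(N_n...N_1)^{-1} B_n}
   as a list with multiplicity (each atom has mass 1/size);
   conv_atoms 0 = [:: 0] is the Dirac mass at 0 (empty convolution). *)
Fixpoint conv_atoms {R : realType} (N : nat -> nat) (B : nat -> seq R) (n : nat)
  : seq R :=
  match n with
  | 0 => [:: 0]
  | m.+1 => [seq x + b / prodN N m | x <- conv_atoms N B m, b <- B m]
  end.

Definition avg {R : realType} (s : seq R) (f : R -> R) : R :=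
  (\sum_(x <- s) f x) / (size s)%:R.

Definition weak_conv_to {R : realType} (N : nat -> nat) (B : nat -> seq R)
  (mu : probability (measurableTypeR R) R) : Prop :=
  forall f : R -> R, continuous f -> (exists M : R, forall x, `|f x| <= M) ->
    (fun n => (avg (conv_atoms N B n.+1) f)%:E) @ \oo -->
      (\int[mu]_x (f x)%:E)%E.

Definition inf_conv_exists {R : realType} (N : nat -> nat) (B : nat -> seq R)
  : Prop :=
  exists mu : probability (measurableTypeR R) R, weak_conv_to N B mu.

Definition card_B2 {R : realType} (N : nat -> nat) (B : nat -> seq R) (n : nat)
  : nat :=
  count (fun b => b \notin [seq (k%:R : R) | k <- iota 0 (N n)]) (B n).

Definition maxabs {R : realType} (s : seq R) : R :=
  \big[Num.max/0]_(b <- s) `|b|.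

(* Main.v *)
(* Existence.  On ([0, 1], Lebesgue) the law of conv_atoms N B n is realised by
   S_n(u) = the atom whose position in the list is the index of the cell of the
   regular subdivision of [0, 1] containing u.  Passing from n to n+1 divides
   every cell into #B_{n+1} equal parts, so S_{n+1} - S_n = b / P_{n+1} with b
   uniform on B_{n+1}, where P_n = N_1 ... N_n.  The digits of B_{n,1} contribute at most
   (N_n - 1) / P_n = 1 / P_{n-1} - 1 / P_n, which telescopes, and by
   Borel-Cantelli almost surely only finitely many digits lie in B_{n,2}; hence
   S_n converges almost surely and its limit has the required law.

   Non-existence.  Let q_k(t) be the squared modulus of the characteristic
   function of X_k, uniform on P_k^-1 B_k.  If mu exists, the products of the
   q_k(t) converge to |hat mu(t)|^2, which is at least 9/16 on some [0, d], so
   the sums of the 1 - q_k(t) are at most 1 there.  Integrating over t, with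
   1 - q_k(t) = E[1 - cos(t (X_k - X_k'))] for an independent copy X_k', gives
   sum_k P(|X_k - X_k'| > r / 2) < oo.  As the characteristic function of X_k
   tends to 1 on [0, d], X_k tends to 0 in probability, so
   P(|X_k - X_k'| > r / 2) >= P(|X_k| > r) / 2 for large k. *)

Require Import Defs.
From HB Require Import structures.
From mathcomp Require Import all_boot all_order all_algebra.
From mathcomp Require Import all_classical all_reals all_analysis.
From mathcomp Require Import ring lra.
Import Order.TTheory GRing.Theory Num.Theory.
Import numFieldNormedType.Exports.
Import measurable_realfun.
Local Open Scope ring_scope.
Local Open Scope classical_set_scope.

(** * Regular subdivisions of the unit interval *)

Lemma nth_allpairs {S T U : Type} (f : S -> T -> U) (x : S) (y : T) (z : U)
    (s : seq S) (t : seq T) (i : nat) : (i < size s * size t)%N ->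
  nth z [seq f a b | a <- s, b <- t] i =
  f (nth x s (i %/ size t)) (nth y t (i %% size t)).
Proof.
elim: s i => [|a s IHs] i //=; rewrite mulSn => ilt.
have t0 : (0 < size t)%N by case: (size t) ilt => //; rewrite muln0.
rewrite nth_cat size_map; case: ltnP => it.
  by rewrite (nth_map y)// divn_small// modn_small.
rewrite IHs; last by rewrite ltn_subLR.
by rewrite -{3 4}(subnK it) divnDr ?dvdnn// divnn t0 addn1 modnDr.
Qed.

(* The index of the k-th part of [0, 1] containing u; the minimum puts u = 1 in
   the last part. *)
Definition cell {R : realType} (k : nat) (u : R) : nat :=
  minn (Num.truncn (u * k%:R)) k.-1.

Lemma cell_lt {R : realType} (k : nat) (u : R) : (0 < k)%N -> (cell k u < k)%N.
Proof. by case: k => // k _; rewrite /cell /= ltnS geq_minr. Qed.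

Lemma le_cell {R : realType} (k : nat) : {homo @cell R k : u v / u <= v >-> (u <= v)%N}.
Proof.
move=> u v uv; rewrite /cell leq_min geq_minr andbT.
by rewrite (leq_trans (geq_minl _ _))// le_truncn// ler_wpM2r.
Qed.

(** Truncating in two stages is harmless, floor(floor(u k m) / m) = floor(u k), and the caps agree
    because the quotient of k m - 1 by m is k - 1. This makes successive subdivisions nested. *)
Lemma cellM {R : realType} (k m : nat) (u : R) : (0 < k)%N -> (0 < m)%N ->
  (cell (k * m) u %/ m = cell k u)%N.
Proof.
move=> k0 m0.
have trE : (Num.truncn (u * (k * m)%:R) %/ m = Num.truncn (u * k%:R))%N.
  (* For negative [u] every truncation takes the default value 0. *)
  have [u0|u0] := ltP u 0.
    have tn j : Num.truncn (u * j%:R) = 0%N.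
      by apply/truncn0Pn; rewrite -ltNge (le_lt_trans _ ltr01)// mulr_le0_ge0// ltW.
    by rewrite !tn div0n.
  have uk0 : 0 <= u * k%:R by rewrite mulr_ge0.
  have /andP[t1 t2] := truncn_itv uk0.
  apply/eqP; rewrite eqn_leq; apply/andP; split.
    rewrite -ltnS ltn_divLR// truncn_lt_nat ?mulr_ge0// !natrM mulrA.
    by rewrite ltr_pM2r ?ltr0n.
  by rewrite leq_divRL// truncn_ge_nat ?mulr_ge0// !natrM mulrA ler_pM2r ?ltr0n.
rewrite /cell; have -> : ((k * m).-1 = k.-1 * m + m.-1)%N.
  by rewrite -[in LHS](prednK k0) mulSn addnC -[in LHS](prednK m0) addnS prednK.
have E : ((k.-1 * m + m.-1) %/ m = k.-1)%N.
  by rewrite divnMDl// [(m.-1 %/ m)%N]divn_small ?addn0// prednK.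
rewrite -trE -[in RHS]E; set a := Num.truncn _; set b := (_ + _)%N.
have [ab|/ltnW ba] := leqP a b.
  by rewrite !(minn_idPl _)// leq_div2r.
by rewrite !(minn_idPr _)// leq_div2r.
Qed.

(** Monotonicity of [cell] makes its fibres intervals. *)
Lemma measurable_cell {R : realType} (k i : nat) :
  measurable ([set u : R | cell k u = i] : set (measurableTypeR R)).
Proof.
apply: is_interval_measurable => u w /= ui wi v /andP[uv vw].
by apply/eqP; rewrite eqn_leq -{1}wi -ui !le_cell.
Qed.

Definition unif01 {R : realType} : probability (measurableTypeR R) R :=
  uniform_prob (@ltr01 R).

Lemma unif01_cell {R : realType} (k i : nat) : (i < k)%N ->
  unif01 [set u : R | cell k u = i] = (k%:R^-1)%:E.
Proof.
move=> ik; have k0 : (0 < k)%N by exact: leq_ltn_trans ik.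
have k0R : 0 < k%:R :> R by rewrite ltr0n.
have mE := @measurable_cell R k i.
set E := [set u | _] in mE *.
have -> : unif01 E = lebesgue_measure (E `&` `[0%R, 1%R])%classic.
  rewrite -[E in LHS]setIT -integral_indic//.
  rewrite integral_uniform//; last first.
    by apply/measurable_EFinP; exact: measurable_indic.
  by rewrite subr0 invr1 mul1e integral_indic.
(* The length is 1/k whichever endpoints are included. The part of the cell in [0, 1] is squeezed
   between the open and the closed interval, so its own endpoints need not be determined. *)
have iv (a b : bool) : lebesgue_measure
    [set` Interval (BSide a (i%:R / k%:R : R)) (BSide b (i.+1%:R / k%:R))] =
    (k%:R^-1)%:E.
  rewrite lebesgue_measure_itv/= lte_fin ltr_pM2r ?invr_gt0// ltr_nat ltnSn.
  by rewrite -EFinB -mulrBl -natrB// subSnn mul1r.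
have ik1 : i.+1%:R / k%:R <= 1 :> R by rewrite ler_pdivrMr// mul1r ler_nat.
have ik0 : 0 <= i%:R / k%:R :> R by rewrite divr_ge0.
have mEI : measurable (E `&` `[0%R, 1%R])%classic by exact: measurableI.
apply/eqP; rewrite eq_le; apply/andP; split.
  rewrite -(iv true false); apply: le_measure; rewrite ?inE//.
  move=> u [/= Eu]; rewrite !in_itv/= => /andP[u0 u1].
  have uk0 : 0 <= u * k%:R by rewrite mulr_ge0// ltW.
  have /andP[t1 t2] := truncn_itv uk0.
  rewrite ler_pdivrMr// ler_pdivlMr//; apply/andP; split.
    by rewrite (le_trans _ t1)// ler_nat -Eu geq_minl.
  have [h|h] := ltnP (Num.truncn (u * k%:R)) k.-1.
    by rewrite -Eu /cell (minn_idPl (ltnW h)) ltW.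
  by rewrite -Eu /cell (minn_idPr h) prednK// ler_piMl// ltW.
rewrite -(iv false true); apply: le_measure; rewrite ?inE//.
move=> u; rewrite /= !in_itv/= => /andP[u0 u1].
have u0' : 0 <= u by rewrite ltW// (le_lt_trans _ u0).
split; last by rewrite u0' (ltW (lt_le_trans u1 _)).
rewrite /E /= /cell (@truncn_def _ _ i).
  by apply/minn_idPl; rewrite -ltnS prednK.
by rewrite -ler_pdivrMr// -ltr_pdivlMr// u1 ltW.
Qed.

Lemma fun_cellE {R : realType} (k : nat) (h : nat -> R) : (0 < k)%N ->
  (fun u : R => h (cell k u)) =
  (fun u : R => \sum_(i < k) h i * \1_[set u | cell k u = i] u).
Proof.
move=> k0; apply/funext => u; rewrite (bigD1 (Ordinal (cell_lt k u k0)))//=.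
rewrite indicE mem_set//= mulr1 big1 ?addr0// => j jk.
rewrite indicE memNset ?mulr0// => /= cj; move/eqP: jk; apply.
by apply/val_inj.
Qed.

Lemma measurable_fun_cell {R : realType} (k : nat) (h : nat -> R) : (0 < k)%N ->
  measurable_fun [set: measurableTypeR R] (fun u : R => h (cell k u)).
Proof.
move=> k0; rewrite fun_cellE//; apply: measurable_sum => i.
apply: measurable_funM => //; apply: measurable_indic.
exact: measurable_cell.
Qed.

Lemma integral_cell {R : realType} (k : nat) (h : nat -> R) : (0 < k)%N ->
  (\int[unif01]_u (h (cell k u))%:E)%E = ((\sum_(i < k) h i) / k%:R)%:E.
Proof.
move=> k0.
transitivity (\int[@unif01 R]_u (\sum_(i < k) ((h i)%:E *
     (\1_[set u | cell k u = i] u)%:E)))%E.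
  apply: eq_integral => u _; have /(congr1 (fun f => f u)) -> := fun_cellE k h k0.
  by rewrite -sumEFin; apply: eq_bigr => i _; rewrite EFinM.
have ind (i : 'I_k) : unif01.-integrable [set: measurableTypeR R]
    (fun u => (\1_[set u | cell k u = i] u)%:E).
  by apply: integrable_indic; exact: measurable_cell.
rewrite integral_sum//; last by move=> i; exact: integrableZl.
rewrite mulr_suml -sumEFin; apply: eq_bigr => i _.
rewrite integralZl// integral_indic//; last exact: measurable_cell.
by rewrite setIT EFinM; congr (_ * _)%E; exact: unif01_cell.
Qed.

(** * Existence of the infinite convolution *)

Lemma sum_count {R : realType} {T : Type} (P : pred T) (s : seq T) :
  \sum_(x <- s) (P x)%:R = (count P s)%:R :> R.
Proof.
by elim: s => [|x s IHs] /=; rewrite ?big_nil// big_cons IHs natrD.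
Qed.

Lemma sum_allpairs {R : realType} {S T U : Type} (f : S -> T -> U) (g : U -> R)
    (s : seq S) (t : seq T) :
  \sum_(z <- [seq f a b | a <- s, b <- t]) g z =
  \sum_(a <- s) \sum_(b <- t) g (f a b).
Proof.
elim: s => [|a s IHs] /=; first by rewrite !big_nil.
by rewrite big_cat/= big_map big_cons IHs.
Qed.

Lemma size_conv_atomsS {R : realType} (N : nat -> nat) (B : nat -> seq R) (n : nat) :
  size (conv_atoms N B n.+1) = (size (conv_atoms N B n) * size (B n))%N.
Proof. by rewrite /= size_allpairs. Qed.

Lemma size_conv_atoms_gt0 {R : realType} (N : nat -> nat) (B : nat -> seq R) (n : nat) :
  (forall n, (0 < size (B n))%N) -> (0 < size (conv_atoms N B n))%N.
Proof.
by move=> hB; elim: n => // n IHn; rewrite size_conv_atomsS muln_gt0 IHn hB.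
Qed.

Lemma integral_nth_cell {R : realType} {T : Type} (x : T) (s : seq T) (g : T -> R) :
  (0 < size s)%N ->
  (\int[unif01]_u (g (nth x s (cell (size s) u)))%:E)%E =
  ((\sum_(y <- s) g y) / (size s)%:R)%:E.
Proof.
move=> s0; rewrite (integral_cell _ (fun i => g (nth x s i)))//.
by rewrite (big_nth x) big_mkord.
Qed.

(** Only a tail is dominated, so both series are first shifted by [n]; the comparison test then
    gives absolute convergence. *)
Lemma is_cvg_series_dominated {R : realType} (u c : R^nat) (n : nat) :
  (forall j, (n <= j)%N -> `|u j| <= c j) -> cvgn (series c) -> cvgn (series u).
Proof.
have shift (v : R^nat) : cvgn (series v) = cvgn (series (fun k => v (k + n)%N)).
  rewrite -(is_cvg_series_restrict n); set w := (fun k => \sum_(n <= i < k) v i).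
  have -> : series (fun k => v (k + n)%N) = (fun m => w (m + n)%N).
    by apply/funext => m; rewrite /w /series/= -{2}[n]add0n big_addn addnK.
  apply/propext; split => /cvg_ex[l]; [rewrite -(cvg_shiftn n)|rewrite cvg_shiftn];
    by move=> wl; apply/cvg_ex; exists l.
move=> uc; rewrite (shift u) (shift c) => cc; apply: normed_cvg.
have uc' k : `|u (k + n)%N| <= c (k + n)%N by rewrite uc// leq_addl.
by apply: (series_le_cvg _ _ _ cc) => //= k; rewrite (le_trans _ (uc' k)).
Qed.

(** Common source of both criteria: digits that are not [bad] move the sum by summable amounts [c],
    while the bad ones have summable probabilities and so almost surely occur finitely often. *)
Lemma exists_inf_conv {R : realType} (N : nat -> nat) (B : nat -> seq R)
    (bad : nat -> pred R) (c : R^nat) :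
  (forall n, (0 < size (B n))%N) ->
  (forall n b, b \in B n -> ~~ bad n b -> `|b / prodN N n| <= c n) ->
  cvgn (series c) ->
  (\sum_(0 <= n <oo) ((count (bad n) (B n))%:R / (size (B n))%:R : R)%:E < +oo)%E ->
  inf_conv_exists N B.
Proof.
move=> B0 Bc cc badoo.
pose a n := conv_atoms N B n.
have a0 n : (0 < size (a n))%N by exact: size_conv_atoms_gt0.
pose S n (u : R) := nth 0 (a n) (cell (size (a n)) u) : R.
(* [d n] lists the last digit of each atom of [a n.+1] in the same order, so one cell index of [u]
   selects both the atom and its digit. *)
pose d n := [seq b | x <- a n, b <- B n].
pose D n (u : R) := nth 0 (d n) (cell (size (d n)) u) : R.
have szd n : size (d n) = size (a n.+1) by rewrite /d /a /= !size_allpairs.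
have d0 n : (0 < size (d n))%N by rewrite szd.
have SS n u : S n.+1 u = S n u + D n u / prodN N n.
  have clt : (cell (size (a n.+1)) u < size (a n) * size (B n))%N.
    by rewrite -size_conv_atomsS cell_lt.
  rewrite /S /D szd (nth_allpairs _ 0 0)// {1}/a /= (nth_allpairs _ 0 0)//.
  by rewrite size_conv_atomsS cellM.
have mS n : measurable_fun [set: measurableTypeR R] (S n).
  exact: measurable_fun_cell.
pose E n : set (measurableTypeR R) := [set u | bad n (D n u)].
have EE n : (fun u => \1_(E n) u) = (fun u => (bad n (D n u))%:R) :> (R -> R).
  apply/funext => u; rewrite indicE; congr (_ %:R); congr nat_of_bool.
  by apply/idP/idP; [rewrite inE|move=> ?; rewrite inE].
have mE n : measurable (E n).
  have -> : E n = \bigcup_(i in [set i | bad n (nth 0 (d n) i)])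
      [set u | cell (size (d n)) u = i].
    apply/seteqP; split => u; first by move=> Eu; exists (cell (size (d n)) u).
    by case=> i /= bi ui; rewrite /E /= /D ui.
  by apply: bigcup_measurable => i _; exact: measurable_cell.
(* Each digit is repeated [size (a n)] times in [d n], and this factor cancels in the proportion. *)
have PE n : unif01 (E n) = ((count (bad n) (B n))%:R / (size (B n))%:R)%:E.
  rewrite -[E n]setIT -integral_indic//.
  transitivity (\int[unif01]_u ((bad n (D n u))%:R : R)%:E)%E.
    by apply: eq_integral => u _; have /(congr1 (fun f => f u)) -> := EE n.
  rewrite (integral_nth_cell _ _ (fun b => (bad n b)%:R))//.
  congr EFin; rewrite sum_allpairs big_const_seq count_predT iter_addr_0 size_allpairs.
  rewrite sum_count natrM -[_ *+ size (a n)]mulr_natl -mulf_div divff ?mul1r//.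
  by rewrite pnatr_eq0 -lt0n.
pose G := ~` lim_sup_set E.
have mlim : measurable (lim_sup_set E).
  by apply: bigcap_measurable => [|n _]; [by exists 0%N|
    apply: bigcup_measurable => j _].
(* First Borel-Cantelli lemma. *)
have Plim : unif01 (lim_sup_set E) = 0%E.
  apply: lim_sup_set_cvg0 => //.
  by rewrite (eq_eseriesr (fun n _ => PE n)).
have mG : measurable G by exact: measurableC.
(* For [u] in [G] no digit is bad from some rank on, so the increments of [S] are dominated by [c]
   from there. *)
have Scvg u : G u -> cvgn (S ^~ u).
  rewrite /G /lim_sup_set setC_bigcap => -[n _ /= nE].
  have -> : S ^~ u = (fun n => S 0%N u + series (fun j => D j u / prodN N j) n).
    apply/funext; elim => [|m IHm]; first by rewrite /series/= big_geq// addr0.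
    by rewrite SS IHm /series /= big_nat_recr//= addrA.
  apply: is_cvgD; first exact: is_cvg_cst.
  apply: (@is_cvg_series_dominated _ _ c n) => // j nj.
  apply: Bc.
    rewrite /D; have : nth 0 (d j) (cell (size (d j)) u) \in d j.
      by rewrite mem_nth// cell_lt.
    by case/allpairsP => -[x b] /= [_ bB ->].
  by apply/negP => bj; apply: nE; exists j.
(* Cutting [S] off outside [G] yields convergence at every point, hence a measurable limit, and
   alters [S] only on a null set. *)
pose T n (u : measurableTypeR R) : R := S n u * \1_G u.
have Tcvg u : cvgn (T ^~ u).
  have [Gu|nGu] := pselect (G u).
    rewrite (_ : T ^~ u = S ^~ u); first exact: Scvg.
    by apply/funext => n; rewrite /T indicE mem_set// mulr1.
  rewrite (_ : T ^~ u = cst 0); first exact: is_cvg_cst.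
  by apply/funext => n; rewrite /T indicE memNset// mulr0.
pose X (u : measurableTypeR R) : R := limn (T ^~ u).
have mX : measurable_fun [set: measurableTypeR R] X.
  apply: (@measurable_fun_cvg _ _ _ _ T) => [m|u _]; last exact: Tcvg.
  by apply: measurable_funM => //; exact: measurable_indic.
have mX' : @measurable_fun _ _ (measurableTypeR R) (measurableTypeR R) setT X.
  exact: mX.
pose Xm := @mfun_Sub _ _ (measurableTypeR R) (measurableTypeR R) X (mem_set mX').
exists (distribution unif01 Xm) => f cf [M fM].
have mf : measurable_fun [set: measurableTypeR R] f.
  exact: continuous_measurable_fun.
have fcvg u : G u -> ((f (S n.+1 u))%:E @[n --> \oo] --> (f (X u))%:E)%classic.
  move=> Gu; apply: cvg_EFin; first exact: nearW.
  apply: (@continuous_cvg _ R R _ _ (fun n => S n.+1 u) f); first exact: cf.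
  rewrite /X (_ : T ^~ u = S ^~ u); last first.
    by apply/funext => n; rewrite /T indicE mem_set// mulr1.
  by rewrite (cvg_shiftS (S ^~ u)); exact: Scvg.
(* The bound [M] on [f] dominates, being integrable for a finite measure. *)
have [|||||fXint _] := @dominated_convergence _ _ _ (@unif01 R) setT measurableT
  (fun n u => (f (S n.+1 u))%:E) (fun u => (f (X u))%:E) (fun=> M%:E).
- by move=> n; apply/measurable_EFinP; exact: measurableT_comp.
- by apply/measurable_EFinP; exact: measurableT_comp.
- exists (lim_sup_set E); split => // u /= ucv; apply: contrapT => nu.
  by apply: ucv => _; exact: fcvg.
- exact: finite_measure_integrable_cst.
- by apply: aeW => u n _; rewrite /= lee_fin.
rewrite integral_distribution//; last exact/measurable_EFinP.
rewrite (_ : (fun n => (avg _ f)%:E) = (fun n => \int[unif01]_u (f (S n.+1 u))%:E)%E)//.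
by apply/funext => n; rewrite (integral_nth_cell _ _ f).
Qed.

Lemma prodNS {R : realType} (N : nat -> nat) (n : nat) :
  prodN N n.+1 = prodN N n * (N n.+1)%:R :> R.
Proof. by rewrite /prodN big_ord_recr. Qed.

Lemma prodN_gt0 {R : realType} (N : nat -> nat) (n : nat) :
  (forall n, (0 < N n)%N) -> 0 < prodN N n :> R.
Proof. by move=> N0; apply: prodr_gt0 => i _; rewrite ltr0n. Qed.

Lemma is_cvg_series_nneseries {R : realType} (u : R^nat) : (forall n, 0 <= u n) ->
  (\sum_(0 <= n <oo) (u n)%:E < +oo)%E -> cvgn (series u).
Proof.
move=> u0 uoo; set s := (\sum_(0 <= n <oo) _)%E in uoo.
have s0 : (0 <= s)%E by apply: nneseries_ge0 => n _ _; rewrite lee_fin.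
have sfin : s \is a fin_num by rewrite ge0_fin_numE.
apply: nondecreasing_is_cvgn; first exact: nondecreasing_series.
exists (fine s) => _ [n _ <-]; rewrite -lee_fin fineK//.
rewrite /series/= -sumEFin; apply: nneseries_lim_ge => k _ _.
by rewrite lee_fin.
Qed.

(* The digits 0, ..., N_n - 1 contribute at most
   (N_n - 1) / P_n = 1 / P_{n-1} - 1 / P_n, where P_n = N_1 ... N_n. *)
Lemma is_cvg_series_digits {R : realType} (N : nat -> nat) :
  (forall n, (0 < N n)%N) ->
  cvgn (series (fun n => (N n).-1%:R / prodN N n : R)).
Proof.
move=> N0; apply: nondecreasing_is_cvgn.
  by apply: nondecreasing_series => n _ _; rewrite divr_ge0// ltW// prodN_gt0.
have predNE n : (N n).-1%:R = (N n)%:R - 1 :> R by rewrite -subn1 natrB.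
have tele n : series (fun n => (N n).-1%:R / prodN N n : R) n.+1 = 1 - (prodN N n)^-1.
  elim: n => [|n IHn].
    rewrite /series/= big_nat1 predNE /prodN big_ord1.
    by rewrite mulrBl mul1r divff// pnatr_eq0 -lt0n.
  rewrite /series/= big_nat_recr//= -[X in X + _]/(series _ _) IHn prodNS predNE.
  rewrite mulrBl mul1r invfM mulrCA divff ?mulr1 ?addrA ?subrK//.
  by rewrite pnatr_eq0 -lt0n.
exists 1 => _ [[|n] _ <-]; first by rewrite /series/= big_geq.
by rewrite tele gerBl invr_ge0 ltW// prodN_gt0.
Qed.

Lemma le_maxabs {R : realType} (s : seq R) (b : R) : b \in s -> `|b| <= maxabs s.
Proof.
elim: s => // a s IHs; rewrite /maxabs big_cons inE le_max => /orP[/eqP ->|/IHs bs].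
  by rewrite lexx.
by rewrite bs orbT.
Qed.

Lemma inf_conv_exists_digits {R : realType} (N : nat -> nat) (B : nat -> seq R) :
  (forall n, (0 < N n)%N) -> (forall n, (0 < size (B n))%N) ->
  (\sum_(0 <= n <oo) (((card_B2 N B n)%:R / (size (B n))%:R : R)%:E) < +oo)%E ->
  inf_conv_exists N B.
Proof.
move=> N0 B0; apply: (exists_inf_conv _ _ _ _ B0 _ (is_cvg_series_digits _ N0)).
move=> n b _ /negPn/mapP[k]; rewrite mem_iota add0n => /andP[_ kN] ->.
rewrite ger0_norm; last by rewrite divr_ge0// ltW// prodN_gt0.
by rewrite ler_pM2r ?invr_gt0 ?prodN_gt0// ler_nat -ltnS prednK.
Qed.

Lemma inf_conv_exists_maxabs {R : realType} (N : nat -> nat) (B : nat -> seq R) :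
  (forall n, (0 < N n)%N) -> (forall n, (0 < size (B n))%N) ->
  (\sum_(0 <= n <oo) ((maxabs (B n) / prodN N n)%:E) < +oo)%E ->
  inf_conv_exists N B.
Proof.
move=> N0 B0 Boo.
have m0 n : 0 <= maxabs (B n) / prodN N n.
  rewrite divr_ge0 ?(ltW (prodN_gt0 _ _ _))//.
  case: (B n) (B0 n) => // b s _.
  by rewrite (le_trans (normr_ge0 b))// le_maxabs// mem_head.
(* No digit is declared bad: the bound by the maximum holds for all of them. *)
apply: (exists_inf_conv _ _ (fun=> xpred0) _ B0 _ (is_cvg_series_nneseries _ m0 Boo)).
  move=> n b bB _; rewrite normrM normfV (gtr0_norm (prodN_gt0 _ _ _))//.
  by rewrite ler_pM2r ?invr_gt0 ?prodN_gt0// le_maxabs.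
rewrite eseries0 ?ltry// => n _ _; by rewrite count_pred0 mul0r.
Qed.

(** * Characteristic functions *)

Lemma avg_cst {R : realType} (s : seq R) (c : R) : (0 < size s)%N ->
  avg s (fun=> c) = c.
Proof.
move=> s0; rewrite /avg big_const_seq count_predT iter_addr_0 -[c *+ _]mulr_natr mulfK//.
by rewrite pnatr_eq0 -lt0n.
Qed.

Lemma avgD {R : realType} (s : seq R) (f g : R -> R) :
  avg s (fun x => f x + g x) = avg s f + avg s g.
Proof. by rewrite /avg big_split mulrDl. Qed.

Lemma avgZl {R : realType} (s : seq R) (c : R) (f : R -> R) :
  avg s (fun x => c * f x) = c * avg s f.
Proof. by rewrite /avg -mulr_sumr mulrA. Qed.

Lemma avgZr {R : realType} (s : seq R) (c : R) (f : R -> R) :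
  avg s (fun x => f x * c) = avg s f * c.
Proof. by rewrite /avg -mulr_suml mulrAC. Qed.

Lemma avgB {R : realType} (s : seq R) (f g : R -> R) :
  avg s (fun x => f x - g x) = avg s f - avg s g.
Proof. by rewrite /avg sumrB mulrBl. Qed.

Lemma eq_avg {R : realType} (s : seq R) (f g : R -> R) :
  f =1 g -> avg s f = avg s g.
Proof. by move=> fg; rewrite /avg (eq_bigr g). Qed.

Lemma le_avg {R : realType} (s : seq R) (f g : R -> R) :
  (forall x, f x <= g x) -> avg s f <= avg s g.
Proof. by move=> fg; rewrite /avg ler_wpM2r// ler_sum. Qed.

Lemma avg_ge0 {R : realType} (s : seq R) (f : R -> R) :
  (forall x, 0 <= f x) -> 0 <= avg s f.
Proof. by move=> f0; rewrite /avg divr_ge0// sumr_ge0. Qed.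

Lemma avg_map {R : realType} (h : R -> R) (s : seq R) (f : R -> R) :
  avg [seq h x | x <- s] f = avg s (fun x => f (h x)).
Proof. by rewrite /avg big_map size_map. Qed.

Lemma avg_allpairs {R : realType} (h : R -> R -> R) (s t : seq R) (f : R -> R) :
  avg [seq h x y | x <- s, y <- t] f = avg s (fun x => avg t (fun y => f (h x y))).
Proof.
rewrite /avg sum_allpairs size_allpairs -mulr_suml natrM invfM.
by rewrite [_^-1 * _]mulrC mulrA.
Qed.

Lemma avg_count {R : realType} (P : pred R) (s : seq R) :
  avg s (fun x => (P x)%:R) = (count P s)%:R / (size s)%:R.
Proof. by rewrite /avg sum_count. Qed.

Definition scaled {R : realType} (N : nat -> nat) (B : nat -> seq R) (n : nat) :=
  [seq b / prodN N n | b <- B n].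

(** With [sinavg], the real and imaginary parts of the characteristic function of the uniform
    distribution on [s]; the argument thus stays within the reals. *)
Definition cosavg {R : realType} (s : seq R) (t : R) := avg s (fun x => cos (t * x)).

Definition sinavg {R : realType} (s : seq R) (t : R) := avg s (fun x => sin (t * x)).

(* The squared modulus of the characteristic function of the uniform
   distribution on [s]. *)
Definition charsq {R : realType} (s : seq R) (t : R) :=
  cosavg s t ^+ 2 + sinavg s t ^+ 2.

Lemma conv_atomsS {R : realType} (N : nat -> nat) (B : nat -> seq R) (n : nat) :
  conv_atoms N B n.+1 = [seq x + y | x <- conv_atoms N B n, y <- scaled N B n].
Proof. by rewrite /scaled allpairs_mapr. Qed.

Lemma size_scaled {R : realType} (N : nat -> nat) (B : nat -> seq R) (n : nat) :
  size (scaled N B n) = size (B n).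
Proof. exact: size_map. Qed.

Lemma cosavgD {R : realType} (s r : seq R) (t : R) :
  cosavg [seq x + y | x <- s, y <- r] t =
  cosavg s t * cosavg r t - sinavg s t * sinavg r t.
Proof.
rewrite /cosavg avg_allpairs -!avgZr -avgB; apply: eq_avg => x.
by rewrite /sinavg -!avgZl -avgB; apply: eq_avg => y; rewrite mulrDr cosD.
Qed.

Lemma sinavgD {R : realType} (s r : seq R) (t : R) :
  sinavg [seq x + y | x <- s, y <- r] t =
  sinavg s t * cosavg r t + cosavg s t * sinavg r t.
Proof.
rewrite /sinavg avg_allpairs -!avgZr -avgD; apply: eq_avg => x.
by rewrite /cosavg -!avgZl -avgD; apply: eq_avg => y; rewrite mulrDr sinD.
Qed.

Lemma charsqD {R : realType} (s r : seq R) (t : R) :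
  charsq [seq x + y | x <- s, y <- r] t = charsq s t * charsq r t.
Proof. by rewrite /charsq cosavgD sinavgD; ring. Qed.

(* The atoms of the symmetrization of the uniform distribution on [s]. *)
Definition diffs {R : realType} (s : seq R) := [seq x - y | x <- s, y <- s].

(** Symmetrizing multiplies the characteristic function by its conjugate. Hence 1 - [charsq] is an
    average of 1 - cos. *)
Lemma cosavg_diffs {R : realType} (s : seq R) (t : R) :
  cosavg (diffs s) t = charsq s t.
Proof.
rewrite /cosavg /charsq avg_allpairs !expr2 -!avgZr -avgD; apply: eq_avg => x.
by rewrite /sinavg -!avgZl -avgD; apply: eq_avg => y; rewrite mulrBr cosB.
Qed.

Lemma size_diffs {R : realType} (s : seq R) : size (diffs s) = (size s * size s)%N.
Proof. exact: size_allpairs. Qed.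

Lemma charsq_ge0 {R : realType} (s : seq R) (t : R) : 0 <= charsq s t.
Proof. by rewrite addr_ge0 ?sqr_ge0. Qed.

Lemma charsq_le1 {R : realType} (s : seq R) (t : R) : (0 < size s)%N -> charsq s t <= 1.
Proof.
move=> s0; rewrite -cosavg_diffs -[leRHS](@avg_cst _ (diffs s)).
  by apply: le_avg => x; exact: cos_le1.
by rewrite size_diffs muln_gt0 s0.
Qed.

Lemma charsq_conv_atoms {R : realType} (N : nat -> nat) (B : nat -> seq R) (n : nat) (t : R) :
  charsq (conv_atoms N B n) t = \prod_(0 <= k < n) charsq (scaled N B k) t.
Proof.
elim: n => [|n IHn]; last by rewrite conv_atomsS charsqD IHn big_nat_recr.
rewrite big_geq// /charsq /cosavg /sinavg /avg !big_seq1 mulr0 cos0 sin0.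
by rewrite mul0r divr1 expr1n expr0n addr0.
Qed.

(** Turns a lower bound on a product into an upper bound on the sum of the defects. In the
    induction, with p and s the current product and sum, x p (1 + s) <= x and p x (1 - x) <= 1 - x
    add up to 1. *)
Lemma prod_mul_sum_compl_le1 {R : realType} (x : nat -> R) (n : nat) :
  (forall k, 0 <= x k <= 1) ->
  (\prod_(0 <= k < n) x k) * (1 + \sum_(0 <= k < n) (1 - x k)) <= 1.
Proof.
move=> x01; elim: n => [|n IHn]; first by rewrite !big_geq// mulr1 addr0.
have : \prod_(0 <= k < n) x k <= 1.
  rewrite -[leRHS](expr1n R (n - 0)) -prodr_const_nat.
  by apply: ler_prod => k _; exact: x01.
have : 0 <= \prod_(0 <= k < n) x k.
  by apply: prodr_ge0 => k _; case/andP: (x01 k).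
rewrite !big_nat_recr//=; move: IHn.
set p := \prod_(_ <= _ < _) _; set s := \sum_(_ <= _ < _) _ => ps p0 p1.
have /andP[y0 y1] := x01 n.
have h1 : x n * (p * (1 + s)) <= x n * 1 by rewrite ler_wpM2l.
have h2 : p * (x n * (1 - x n)) <= 1 - x n.
  rewrite mulrA ler_piMl ?subr_ge0// mulr_ile1//.
lra.
Qed.

(** For a single t the gap 1 - cos(t y) vanishes at arbitrarily large y; integrating over t removes
    these zeros, so that the result detects tails. *)
Definition cosgap {R : realType} (d y : R) : R :=
  (\int[lebesgue_measure]_(t in `[0%R, d]) (1 - cos (t * y)))%R.

Lemma continuous_cosgap {R : realType} (y : R) : continuous (fun t : R => 1 - cos (t * y)).
Proof.
move=> t; apply: cvgB; first exact: cvg_cst.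
apply: (@continuous_cvg _ R R _ _ (fun t => t * y) cos); first exact: continuous_cos.
by apply: cvgMl; exact: cvg_id.
Qed.

Lemma integrable_itv0 {R : realType} (d : R) (f : R -> R) : continuous f ->
  (@lebesgue_measure R).-integrable `[0%R, d] (EFin \o f).
Proof.
move=> cf; apply: continuous_compact_integrable; first exact: segment_compact.
exact: continuous_subspaceT.
Qed.

Lemma cosgap_ge0 {R : realType} (d y : R) : 0 <= cosgap d y.
Proof. by apply: Rintegral_ge0 => t _; rewrite subr_ge0 cos_le1. Qed.

Lemma cosgapN {R : realType} (d y : R) : cosgap d (- y) = cosgap d y.
Proof. by apply: eq_Rintegral => t _; rewrite mulrN cosN. Qed.

Lemma cosgapE {R : realType} (d y : R) : 0 < d -> y != 0 ->
  cosgap d y = d - sin (d * y) / y.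
Proof.
move=> d0 y0; pose F (t : R) := t - sin (t * y) / y.
have dF (t : R) : is_derive t 1 F (1 - cos (t * y)).
  rewrite /F; apply: is_derive_eq; rewrite /GRing.scale/=.
  by rewrite !mulr0 !add0r mulr1 mulrCA mulVf// mulr1.
have cF : continuous F.
  by move=> t; apply: differentiable_continuous; apply/derivable1_diffP; case: (dF t).
rewrite /cosgap /Rintegral (@continuous_FTC2 _ _ F)//.
- by rewrite /= /F !mul0r sin0 mul0r subrr subr0.
- by apply: continuous_subspaceT; exact: continuous_cosgap.
- split.
  + by move=> x _; case: (dF x).
  + by apply: cvg_at_right_filter; exact: cF.
  + by apply: cvg_at_left_filter; exact: cF.
- by move=> x _; rewrite derive1E; apply: derive_val.
Qed.

Lemma sin_MVT {R : realType} (a b : R) : a < b ->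
  exists2 c, c \in `]a, b[%R & sin b - sin a = cos c * (b - a).
Proof.
move=> ab; apply: (@MVT _ sin cos) => //.
by apply: continuous_subspaceT; exact: continuous_sin.
Qed.

Lemma sin_lt {R : realType} (a : R) : 0 < a -> sin a < a.
Proof.
move=> a0; have [a1|a1] := ltP 1 a; first exact: le_lt_trans (sin_le1 a) a1.
have [c] := sin_MVT 0 a a0; rewrite in_itv/= sin0 !subr0 => /andP[c0 ca] ->.
rewrite gtr_pMl// -[ltRHS]cos0 ltr_cos ?in_itv//= ?lexx ?pi_ge0// ltW//=.
by rewrite (le_trans _ (pi_ge2 R))//; lra.
Qed.

Lemma sin_subr_le {R : realType} (a b : R) : a <= b -> sin b - sin a <= b - a.
Proof.
rewrite le_eqVlt => /predU1P[->|ab]; first by rewrite !subrr.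
have [c _ ->] := sin_MVT a b ab.
by rewrite ler_piMl ?cos_le1// subr_ge0 ltW.
Qed.

(** By evenness take y > c. If d y >= 2, then sin(d y) / y <= d / 2 leaves at least d / 2. Otherwise
    x - sin x is nondecreasing, so the gap is at least e / y, and 1 / y > d / 2. *)
Lemma cosgap_lower_bound {R : realType} (d c : R) : 0 < d -> 0 < c ->
  exists2 k, 0 < k & forall y, c < `|y| -> k <= cosgap d y.
Proof.
move=> d0 c0; pose e := d * c - sin (d * c).
have e0 : 0 < e by rewrite subr_gt0 sin_lt// mulr_gt0.
pose k := Num.min (d / 2) (e * d / 2).
have k0 : 0 < k by rewrite lt_min !divr_gt0// mulr_gt0.
exists k => //.
have main y : c < y -> k <= cosgap d y.
  move=> cy; have y0 : 0 < y by exact: lt_trans cy.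
  rewrite cosgapE ?gt_eqF//.
  have [yd|yd] := leP 2 (d * y); rewrite /k ge_min; apply/orP; [left|right].
    have : sin (d * y) / y <= d / 2.
      rewrite ler_pdivrMr// (le_trans (sin_le1 _))//.
      by rewrite mulrAC ler_pdivlMr// mul1r.
    lra.
  have -> : d - sin (d * y) / y = (d * y - sin (d * y)) / y.
    by rewrite mulrBl mulfK// gt_eqF.
  rewrite ler_pdivlMr//.
  have h1 : sin (d * y) - sin (d * c) <= d * y - d * c.
    by apply: sin_subr_le; rewrite ler_pM2l// ltW.
  have h2 : e * (d * y) <= e * 2 by rewrite ler_pM2l// ltW.
  rewrite -!mulrA [2^-1 * y]mulrC !mulrA ler_pdivrMr// -[e * d * y]mulrA.
  apply: (le_trans h2); rewrite ler_pM2r//; rewrite /e; lra.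
move=> y; have [y0|y0] := leP 0 y; first by rewrite ger0_norm//; exact: main.
by rewrite ltr0_norm// => /main; rewrite cosgapN.
Qed.

Lemma continuous_sum {R : realType} {T : Type} (s : seq T) (F : T -> R -> R) :
  (forall y, continuous (F y)) -> continuous (fun t => \sum_(y <- s) F y t).
Proof.
move=> cF; elim: s => [|y s IHs] t.
  by under eq_fun do rewrite big_nil; exact: cvg_cst.
under eq_fun do rewrite big_cons.
by apply: cvgD; [exact: cF|exact: IHs].
Qed.

Lemma Rintegral_sum {R : realType} {T : Type} (d : R) (s : seq T) (F : T -> R -> R) :
  (forall y, continuous (F y)) ->
  (\int[lebesgue_measure]_(t in `[0%R, d]) (\sum_(y <- s) F y t))%R =
  \sum_(y <- s) (\int[lebesgue_measure]_(t in `[0%R, d]) F y t)%R.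
Proof.
move=> cF; elim: s => [|y s IHs].
  rewrite big_nil; under eq_Rintegral do rewrite big_nil.
  by rewrite Rintegral_cst// mul0r.
rewrite big_cons -IHs; under eq_Rintegral do rewrite big_cons.
by rewrite RintegralD//; apply: integrable_itv0 => //; exact: continuous_sum.
Qed.

Lemma continuous_avg {R : realType} (s : seq R) :
  continuous (fun t : R => avg s (fun y => 1 - cos (t * y))).
Proof.
move=> t; apply: cvgMl; apply: continuous_sum => y; exact: continuous_cosgap.
Qed.

(** A finite average commutes with the integral. On [diffs s], for nonempty [s], the integrand is 1
    - [charsq s t]. *)
Lemma avg_cosgap {R : realType} (s : seq R) (d : R) :
  avg s (cosgap d) =
  (\int[lebesgue_measure]_(t in `[0%R, d]) avg s (fun y => 1 - cos (t * y)))%R.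
Proof.
rewrite /avg RintegralZr//; last first.
  by apply: integrable_itv0; apply: continuous_sum => y; exact: continuous_cosgap.
by rewrite Rintegral_sum// => y; exact: continuous_cosgap.
Qed.

(** * Non-existence of the infinite convolution *)

Lemma weak_conv_Rintegral {R : realType} (N : nat -> nat) (B : nat -> seq R)
    (mu : probability (measurableTypeR R) R) (f : R -> R) (M : R) :
  weak_conv_to N B mu -> continuous f -> (forall x, `|f x| <= M) ->
  (avg (conv_atoms N B n) f @[n --> \oo] --> (\int[mu]_x f x)%R).
Proof.
move=> wc cf fM; rewrite -cvg_shiftS /=.
apply: (fine_cvg (f := fun n => (avg (conv_atoms N B n.+1) f)%:E)).
rewrite /Rintegral fineK; first by apply: wc => //; exists M.
apply: integrable_fin_num => //; apply: measurable_bounded_integrable => //.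
- by rewrite (le_lt_trans (probability_le1 _ _))// ltry.
- exact: continuous_measurable_fun.
- by exists M; split; [exact: num_real|move=> x xM y _; exact: le_trans (fM y) (ltW xM)].
Qed.

Lemma continuous_cos_scale {R : realType} (t : R) : continuous (fun x : R => cos (t * x)).
Proof.
move=> x; apply: (@continuous_cvg _ R R _ _ (fun x => t * x) cos).
  exact: continuous_cos.
by apply: cvgMr; exact: cvg_id.
Qed.

Lemma continuous_sin_scale {R : realType} (t : R) : continuous (fun x : R => sin (t * x)).
Proof.
move=> x; apply: (@continuous_cvg _ R R _ _ (fun x => t * x) sin).
  exact: continuous_sin.
by apply: cvgMr; exact: cvg_id.
Qed.

(** The integral is continuous in t, by domination by 1, and equals 1 at t = 0. The value 3/4 is
    chosen so that its square 9/16 exceeds 1/2. *)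
Lemma cos_Rintegral_near0 {R : realType} (mu : probability (measurableTypeR R) R) :
  exists2 d : R, 0 < d &
    forall t, t \in `[0, d]%R -> 3 / 4 <= (\int[mu]_x cos (t * x))%R.
Proof.
have int1 (t : R) : mu.-integrable setT (EFin \o (fun x => cos (t * x))).
  apply: measurable_bounded_integrable => //.
  - by rewrite (le_lt_trans (probability_le1 _ _))// ltry.
  - by apply: continuous_measurable_fun; exact: continuous_cos_scale.
  - exists 1; split; first exact: num_real.
    by move=> x x1 y _; exact: le_trans (cos_max _) (ltW x1).
have : {in (`]-1, 1[ : set R), continuous (fun t : R => \int[mu]_x cos (t * x))%R}.
  apply: (@continuity_under_integral _ _ _ mu _ _ _ _ _ _ _ (cst 1)) => //.
  - apply: aeW => y _ t _.
    have := @continuous_cos_scale R y t; rewrite /continuous_at mulrC.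
    by under eq_fun do rewrite mulrC.
  - exact: finite_measure_integrable_cst.
  - by move=> t _; apply: aeW => y _; exact: cos_max.
move=> cont.
have {cont} : (\int[mu]_x cos (t * x))%R @[t --> (0 : R)] --> (\int[mu]_x cos (0 * x))%R.
  by apply: cont; rewrite inE /= in_itv/= ltrN10 ltr01.
have -> : (\int[mu]_x cos (0 * x))%R = 1 :> R.
  under eq_Rintegral do rewrite mul0r cos0.
  rewrite Rintegral_cst// mul1r; exact: (congr1 fine (probability_setT mu)).
move=> /cvgrPdist_le /(_ (1 / 4)) [|e /= e0 He]; first by lra.
(* Half the radius, since the ball is open and [0, d] is closed. *)
exists (e / 2); first by rewrite divr_gt0.
move=> t; rewrite in_itv/= => /andP[t0 te].
have := He t; rewrite /ball/= sub0r normrN ger0_norm// => /(_ _)/ler_normlP[|_].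
  by rewrite (le_lt_trans te)// ltr_pdivrMr// ltr_pMr// ltr1n.
lra.
Qed.

Lemma sum_charsq_le1 {R : realType} (N : nat -> nat) (B : nat -> seq R) (t c s : R)
    (n : nat) : (forall n, (0 < size (B n))%N) ->
  (cosavg (conv_atoms N B n) t @[n --> \oo] --> c) ->
  (sinavg (conv_atoms N B n) t @[n --> \oo] --> s) ->
  3 / 4 <= c ->
  \sum_(0 <= k < n) (1 - charsq (scaled N B k) t) <= 1.
Proof.
move=> B0 cc cs c34.
have x01 k : 0 <= charsq (scaled N B k) t <= 1.
  by rewrite charsq_ge0 charsq_le1// size_scaled.
have cq : charsq (conv_atoms N B k) t @[k --> \oo] --> c ^+ 2 + s ^+ 2.
  by rewrite /charsq; apply: cvgD; rewrite expr2; apply: cvgM.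
(* Each new factor is at most 1, so every partial product is at least the limit. *)
have nq : {homo (fun k => charsq (conv_atoms N B k) t) : m n / (m <= n)%N >-> n <= m}.
  apply/nonincreasing_seqP => k; rewrite conv_atomsS charsqD.
  by rewrite ler_piMr ?charsq_ge0//; case/andP: (x01 k).
have qn : 9 / 16 <= charsq (conv_atoms N B n) t.
  apply: (@le_trans _ _ (c ^+ 2 + s ^+ 2)); first by nra.
  have <- := cvg_lim _ cq => //.
  by apply: nonincreasing_cvgn_ge => //; apply/cvg_ex; exists (c ^+ 2 + s ^+ 2).
have := @prod_mul_sum_compl_le1 _ (fun k => charsq (scaled N B k) t) n x01.
rewrite -charsq_conv_atoms; set S := \sum_(_ <= _ < _) _.
have S0 : 0 <= S by apply: sumr_ge0 => k _; rewrite subr_ge0; case/andP: (x01 k).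
(* From 9/16 (1 + S) <= 1 follows S <= 7/9. *)
nra.
Qed.

(** Integrate the pointwise bound over [0, d]; the constant 1 integrates to d. *)
Lemma sum_avg_cosgap_le {R : realType} (X : nat -> seq R) (d : R) (n : nat) : 0 < d ->
  (forall k, (0 < size (X k))%N) ->
  (forall t, t \in `[0, d]%R -> \sum_(0 <= k < n) (1 - charsq (X k) t) <= 1) ->
  \sum_(0 <= k < n) avg (diffs (X k)) (cosgap d) <= d.
Proof.
move=> d0 X0 sumX; under eq_bigr do rewrite avg_cosgap.
rewrite -Rintegral_sum; last by move=> k; exact: continuous_avg.
have dE : lebesgue_measure (`[0%R, d]%classic : set R) = d%:E.
  by rewrite lebesgue_measure_itv/= lte_fin d0 sube0.
have dI : (\int[lebesgue_measure]_(t in `[0%R, d]) (1 : R))%R = d.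
  by rewrite Rintegral_cst// mul1r; exact: (congr1 fine dE).
rewrite -[leRHS]dI.
apply: le_Rintegral => //.
- by apply: integrable_itv0; apply: continuous_sum => k; exact: continuous_avg.
- by apply: integrable_itv0 => t; exact: cvg_cst.
move=> t /= td; rewrite (le_trans _ (sumX t td))// ler_sum// => k _.
by rewrite avgB avg_cst ?size_diffs ?muln_gt0 ?X0// -cosavg_diffs.
Qed.

(** Dominated convergence on [0, d], the averages of 1 - cos lying between 0 and 2. *)
Lemma cvg_avg_cosgap0 {R : realType} (X : nat -> seq R) (d : R) : 0 < d ->
  (forall k, (0 < size (X k))%N) ->
  (forall t, t \in `[0, d]%R -> cosavg (X n) t @[n --> \oo] --> (1 : R)) ->
  avg (X n) (cosgap d) @[n --> \oo] --> (0 : R).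
Proof.
move=> d0 X0 Xcvg; under eq_fun do rewrite avg_cosgap.
pose f n (t : R) := avg (X n) (fun y => 1 - cos (t * y)).
have [|||||_ _] := @dominated_convergence _ _ _ (@lebesgue_measure R) `[0%R, d]
    (measurable_itv _) (fun n t => (f n t)%:E) (fun=> 0%E) (fun=> 2%:E) => //.
- move=> n; apply/measurable_EFinP; apply: measurable_funTS.
  by apply: continuous_measurable_fun; exact: continuous_avg.
- apply: aeW => t /Xcvg tX; apply: cvg_EFin; first exact: nearW.
  rewrite /comp/= /f; under eq_fun do rewrite avgB avg_cst//.
  by rewrite -(subrr 1); apply: cvgB => //; exact: cvg_cst.
- by apply: integrable_itv0 => t; exact: cvg_cst.
- apply: aeW => t n _; rewrite /= lee_fin /f ger0_norm.
    rewrite -[leRHS](@avg_cst _ (X n))//; apply: le_avg => y.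
    by have := cos_geN1 (t * y); lra.
  by apply: avg_ge0 => y; rewrite subr_ge0 cos_le1.
rewrite integral0 => h.
by apply: (fine_cvg (f := fun n => \int[lebesgue_measure]_(t in `[0%R, d]) (f n t)%:E)%E).
Qed.

(** If |x| > r and |y| <= r / 2, then |x - y| > r / 2; independence of x and y turns the left side
    into a product. *)
Lemma count_diffs_ge {R : realType} (s : seq R) (r : R) :
  avg s (fun x => (r < `|x|)%R%:R) * (1 - avg s (fun x => (r / 2 < `|x|)%R%:R)) <=
  avg (diffs s) (fun z => (r / 2 < `|z|)%R%:R).
Proof.
have [/size0nil ->|s0] := posnP (size s); first by rewrite /avg !big_nil !mul0r.
rewrite avg_allpairs -avgZr; apply: le_avg => x.
rewrite -[X in _ * (X - _)](@avg_cst _ s)// -avgB -avgZl; apply: le_avg => y.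
have [rx|_] := ltP r `|x|; last by rewrite mul0r.
rewrite mul1r; have [_|yr] := ltP (r / 2) `|y|; first by rewrite subrr.
rewrite (_ : r / 2 < `|x - y|) ?subr0//.
by have := lerB_dist x y; lra.
Qed.

(** Markov's inequality for [cosgap d]. *)
Lemma le_count_cosgap {R : realType} (s : seq R) (d k r : R) :
  (forall y, r < `|y| -> k <= cosgap d y) ->
  k * avg s (fun y => (r < `|y|)%R%:R) <= avg s (cosgap d).
Proof.
move=> kr; rewrite -avgZl; apply: le_avg => y.
by case: ltP => [/kr|_]; rewrite ?mulr1// mulr0 cosgap_ge0.
Qed.

(** The characteristic function of the new term is the quotient of two consecutive ones of the
    partial convolutions, which share a nonzero limit. *)
Lemma cosavg_scaled_cvg1 {R : realType} (N : nat -> nat) (B : nat -> seq R) (t c s : R) :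
  (cosavg (conv_atoms N B n) t @[n --> \oo] --> c) ->
  (sinavg (conv_atoms N B n) t @[n --> \oo] --> s) ->
  c != 0 ->
  (cosavg (scaled N B n) t @[n --> \oo] --> (1 : R)).
Proof.
move=> cc cs c0; pose q n := charsq (conv_atoms N B n) t.
have q0 : c ^+ 2 + s ^+ 2 != 0.
  by rewrite paddr_eq0 ?sqr_ge0// sqrf_eq0 (negbTE c0).
have cq : q n @[n --> \oo] --> c ^+ 2 + s ^+ 2.
  by rewrite /q /charsq; apply: cvgD; rewrite expr2; apply: cvgM.
(* Real part of that quotient, after multiplying numerator and denominator by the conjugate of the
   denominator. *)
pose u n := (cosavg (conv_atoms N B n.+1) t * cosavg (conv_atoms N B n) t +
  sinavg (conv_atoms N B n.+1) t * sinavg (conv_atoms N B n) t) / q n.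
have cu : u n @[n --> \oo] --> (1 : R).
  rewrite -(divff q0); apply: cvgM; last exact: cvgV.
  rewrite !expr2; apply: cvgD; apply: cvgM => //.
  - by rewrite (cvg_shiftS (fun n => cosavg (conv_atoms N B n) t)).
  - by rewrite (cvg_shiftS (fun n => sinavg (conv_atoms N B n) t)).
apply: cvg_trans cu; apply: near_eq_cvg; near=> n.
have qn0 : q n != 0.
  near: n; exact: cvgr_neq0 cq q0.
apply: (mulIf qn0); rewrite /u mulfVK// /q /charsq conv_atomsS cosavgD sinavgD.
ring.
Unshelve. all: by end_near. Qed.

Lemma weak_conv_tails_summable {R : realType} (N : nat -> nat) (B : nat -> seq R)
    (mu : probability (measurableTypeR R) R) (r : R) :
  (forall n, (0 < size (B n))%N) -> weak_conv_to N B mu -> 0 < r ->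
  exists C : R, forall n, \sum_(0 <= k < n) avg (scaled N B k) (fun x => (r < `|x|)%R%:R) <= C.
Proof.
move=> B0 wc r0.
have X0 k : (0 < size (scaled N B k))%N by rewrite size_scaled.
have [d d0 cd] := cos_Rintegral_near0 mu.
have cc t : cosavg (conv_atoms N B n) t @[n --> \oo] --> (\int[mu]_x cos (t * x))%R.
  apply: (@weak_conv_Rintegral _ _ _ _ _ 1 wc); first exact: continuous_cos_scale.
  by move=> x; exact: cos_max.
have cs t : sinavg (conv_atoms N B n) t @[n --> \oo] --> (\int[mu]_x sin (t * x))%R.
  apply: (@weak_conv_Rintegral _ _ _ _ _ 1 wc); first exact: continuous_sin_scale.
  by move=> x; exact: sin_max.
have [k k0 kP] := cosgap_lower_bound d (r / 2) d0 (divr_gt0 r0 (ltr0Sn _ _)).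
(* The threshold k / 2 makes Markov's inequality give P(|X| > r / 2) <= 1/2 from rank [n0] on. *)
have /cvgr_lt/(_ (k / 2)) : avg (scaled N B n) (cosgap d) @[n --> \oo] --> (0 : R).
  apply: cvg_avg_cosgap0 => // t td; apply: (cosavg_scaled_cvg1 _ _ _ _ _ (cc t) (cs t)).
  by apply: lt0r_neq0; apply: lt_le_trans (cd t td); lra.
have k20 : 0 < k / 2 by rewrite divr_gt0.
move=> /(_ k20)[n0 _ small].
pose p j := avg (scaled N B j) (fun x => (r < `|x|)%R%:R).
pose h j := avg (diffs (scaled N B j)) (cosgap d).
have h0 j : 0 <= h j by apply: avg_ge0 => y; exact: cosgap_ge0.
have p01 j : 0 <= p j <= 1.
  apply/andP; split; first by apply: avg_ge0 => y; exact: ler0n.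
  by rewrite -[leRHS](@avg_cst _ (scaled N B j))//; apply: le_avg => y; rewrite lern1 leq_b1.
(* Below [n0] the trivial bound 1 is used. From [n0] on, with q = P(|X| > r / 2) <= 1/2, one has p /
   2 <= p (1 - q) <= P(|X - X'| > r / 2) <= h / k. *)
have ph j : p j <= (j < n0)%:R + 2 / k * h j.
  have kh : 0 <= 2 / k * h j by rewrite mulr_ge0// divr_ge0// ltW.
  have /andP[pj0 pj1] := p01 j.
  have [_|/small/= sj] := ltnP j n0; first by rewrite -[leLHS]addr0 lerD.
  rewrite add0r.
  have c1 := count_diffs_ge (scaled N B j) r.
  have c2 := le_count_cosgap (scaled N B j) d k (r / 2) kP.
  have c3 := le_count_cosgap (diffs (scaled N B j)) d k (r / 2) kP.
  rewrite mulrAC ler_pdivlMr//.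
  rewrite -/(p j) in c1; rewrite -/(h j) in c3.
  move: c1 c2 c3; set q := avg _ _ => c1 c2 c3.
  have q2 : q <= 1 / 2.
    have : k * q < k / 2 by exact: le_lt_trans sj.
    by rewrite ltr_pM2l// div1r => /ltW.
  have : p j * (1 / 2) <= p j * (1 - q) by rewrite ler_wpM2l//; lra.
  move=> pq; have := le_trans pq c1; rewrite -(ler_pM2l k0).
  move=> /le_trans/(_ c3); lra.
(* At most [n0] indices use the trivial bound, and the [h j] sum to at most [d]. *)
exists (n0%:R + 2 / k * d) => n.
apply: (@le_trans _ _ (\sum_(0 <= j < n) ((j < n0)%:R + 2 / k * h j))).
  by apply: ler_sum => j _; exact: ph.
rewrite big_split/= -mulr_sumr lerD//.
  rewrite sum_count ler_nat.
  rewrite -size_filter -[leqRHS](size_iota 0 n0) uniq_leq_size ?filter_uniq ?iota_uniq//.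
  by move=> j; rewrite mem_filter mem_iota => /andP[].
rewrite ler_pM2l ?divr_gt0//; apply: sum_avg_cosgap_le => // t td.
exact: (sum_charsq_le1 _ _ _ _ _ _ B0 (cc t) (cs t) (cd t td)).
Qed.

Lemma not_inf_conv_exists {R : realType} (N : nat -> nat) (B : nat -> seq R) (r : R) :
  (forall n, (0 < N n)%N) -> (forall n, (0 < size (B n))%N) -> 0 < r ->
  (\sum_(0 <= n <oo)
     (((count (fun b => `|b| > prodN N n * r) (B n))%:R
        / (size (B n))%:R : R)%:E) = +oo)%E ->
  ~ inf_conv_exists N B.
Proof.
move=> N0 B0 r0 Boo [mu wc].
have [C hC] := weak_conv_tails_summable _ _ _ _ B0 wc r0.
(* Dividing by [prodN N n] turns the counted digits into the tail |x| > r of [scaled N B n], so [C]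
   bounds all partial sums of the divergent series. *)
suff : (+oo <= C%:E :> \bar R)%E by rewrite leye_eq.
rewrite -Boo; apply: lime_le.
  by apply: is_cvg_nneseries => n _ _; rewrite lee_fin.
apply: nearW => n; rewrite sumEFin lee_fin (le_trans _ (hC n))// ler_sum// => k _.
rewrite avg_map avg_count ler_wpM2r// ler_nat sub_count// => b /=.
by rewrite normrM normfV (gtr0_norm (prodN_gt0 _ _ N0)) ltr_pdivlMr ?prodN_gt0// mulrC.
Qed.

Theorem theorem2p1 (R : realType) (N : nat -> nat) (B : nat -> seq R)
  (hN : forall n, (0 < N n)%N)
  (hBu : forall n, uniq (B n))
  (hBs : forall n, (2 <= size (B n))%N) :
  ((\sum_(0 <= n <oo) (((card_B2 N B n)%:R / (size (B n))%:R : R)%:E) < +oo)%E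
    \/ (\sum_(0 <= n <oo) ((maxabs (B n) / prodN N n)%:E) < +oo)%E ->
    inf_conv_exists N B)
  /\
  ((exists r0 : R, 0 < r0 /\
      (\sum_(0 <= n <oo)
         (((count (fun b => `|b| > prodN N n * r0) (B n))%:R
            / (size (B n))%:R : R)%:E) = +oo)%E) ->
    ~ inf_conv_exists N B).
Proof.
have hB0 n : (0 < size (B n))%N by exact: ltnW (hBs n).
split; first by case; [exact: inf_conv_exists_digits|exact: inf_conv_exists_maxabs].
by move=> [r0 [r0_gt0 hoo]]; exact: (not_inf_conv_exists N B r0 hN hB0 r0_gt0 hoo).
Qed.
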